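(* Let $*$ be a continuous t-norm on $[0,1]$. Then the quantale $\Delta_*=(\Delta,\otimes_*,\kappa_{0,1})$ of distance distributions is non-divisible.
   Context: A continuous t-norm $*$ is a continuous, associative, commutative binary operation on $[0,1]$, monotone in each variable, with unit $1$. A distance distribution is a map $\varphi:[0,\infty]\to[0,1]$ with $\varphi(t)=\bigvee_{s<t}\varphi(s)$ for all $t\in[0,\infty]$ (the usual order on $[0,\infty]$; the empty join in $[0,1]$ is $0$, so $\varphi(0)=0$). $\Delta$ is the complete lattice of all distance distributions with the pointwise order. The convolution of $\varphi,\psi\in\Delta$ is $(\varphi\otimes_*\psi)(t)=\bigvee_{r+s=t}\varphi(r)*\psi(s)$ for $t\in[0,\infty]$ ($r,s\in[0,\infty]$, with $p+\infty=\infty+p=\infty$). Let $\kappa_{0,1}\in\Delta$ be given by $\kappa_{0,1}(0)=0$ and $\kappa_{0,1}(t)=1$ for $t>0$. $\Delta_*=(\Delta,\otimes_*,\kappa_{0,1})$ is a commutative and integral quantale (i.e., $\otimes_*$ is a commutative associative operation preserving arbitrary suprema in each variable, whose unit $\kappa_{0,1}$ is the top element). A commutative integral quantale $(\mathsf{Q},\&,1)$ is divisible if for all $d\leq q$ in $\mathsf{Q}$ there exists $p\in\mathsf{Q}$ with $q\mathbin{\&}p=d$ (equivalently, $q\mathbin{\&}(q\to d)=d$, where $q\mathbin{\&}p\leq r\iff p\leq q\to r$); it is non-divisible otherwise. *)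

(* Defs.v *)
From HB Require Import structures.
From mathcomp Require Import all_boot all_order all_algebra.
From mathcomp Require Import all_classical all_reals all_analysis.

Set Implicit Arguments.
Unset Strict Implicit.
Unset Printing Implicit Defensive.

Import Order.TTheory GRing.Theory Num.Theory.
Import numFieldNormedType.Exports.

Local Open Scope classical_set_scope.
Local Open Scope ring_scope.

(* qmul preserves all joins of Q in its second variable, hence, by
   commutativity, in each of them. *)
Record comm_integral_quantale (d : Order.disp_t) := CommIntegralQuantale {
  qsort :> porderType d;
  qmul : qsort -> qsort -> qsort;
  qone : qsort;
  qcomplete : forall A : set qsort, exists s, isLub A s;
  qmulA : associative qmul;
  qmulC : commutative qmul;
  qmul1q : left_id qone qmul;
  qmul_lub : forall (q : qsort) (A : set qsort) (s : qsort),
    isLub A s -> isLub (qmul q @` A) (qmul q s);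
  qone_top : forall q : qsort, (q <= qone)%O
}.

Definition divisible d (Q : comm_integral_quantale d) : Prop :=
  forall c q : Q, (c <= q)%O -> exists p : Q, qmul q p = c.

(* The values of a t-norm outside [0,1] x [0,1] are irrelevant. Monotonicity
   and the unit law are stated on one side only, as a t-norm is commutative. *)
Record ctnorm (R : realType) := CTNorm {
  tnorm :> R -> R -> R;
  tnorm01 : {in `[0, 1] &, forall x y, tnorm x y \in `[0, 1]};
  tnormA : {in `[0, 1] & &, associative tnorm};
  tnormC : {in `[0, 1] &, commutative tnorm};
  tnorm_mono : {in `[0, 1] & &, forall x y z, y <= z -> tnorm x y <= tnorm x z};
  tnorm1x : {in `[0, 1], left_id 1 tnorm};
  tnorm_continuous : {within (`[0, 1] `*` `[0, 1] : set (R * R)),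
    continuous (fun xy : R * R => tnorm xy.1 xy.2)}
}.

Section UnitInterval.
Variable R : realType.
Implicit Types (A : set R) (x y z M : R).

Lemma sup01_ub A x : A `<=` `[0, 1] -> A x -> x <= sup A.
Proof.
move=> A01 Ax; apply: ub_le_sup => //; exists 1 => y /A01 /=.
by rewrite in_itv /= => /andP[].
Qed.

Lemma sup01_le A M : 0 <= M -> (forall x, A x -> x <= M) -> sup A <= M.
Proof.
move=> M0 AM; have [->|/set0P A0] := eqVneq A set0; first by rewrite sup0.
exact: ge_sup.
Qed.

Lemma sup01_in A : A `<=` `[0, 1] -> sup A \in `[0, 1].
Proof.
move=> A01; rewrite in_itv /=; apply/andP; split; last first.
  by apply: sup01_le => // x /A01 /=; rewrite in_itv /= => /andP[].
have [->|/set0P[x Ax]] := eqVneq A set0; first by rewrite sup0.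
by apply: le_trans (sup01_ub A01 Ax); have := A01 _ Ax; rewrite /= in_itv /= => /andP[].
Qed.

Variable T : ctnorm R.

Lemma in01_0 : (0 : R) \in `[0, 1]. Proof. by rewrite in_itv /= lexx ler01. Qed.
Lemma in01_1 : (1 : R) \in `[0, 1]. Proof. by rewrite in_itv /= lexx ler01. Qed.
Lemma in01_ge0 x : x \in `[0, 1] -> 0 <= x.
Proof. by rewrite in_itv /= => /andP[]. Qed.
Lemma in01_le1 x : x \in `[0, 1] -> x <= 1.
Proof. by rewrite in_itv /= => /andP[]. Qed.

Lemma tnorm_le x x' y y' : x \in `[0, 1] -> x' \in `[0, 1] ->
  y \in `[0, 1] -> y' \in `[0, 1] -> x <= x' -> y <= y' -> T x y <= T x' y'.
Proof.
move=> hx hx' hy hy' xx' yy'; apply: le_trans (tnorm_mono T hx hy hy' yy') _.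
by rewrite (tnormC T hx hy') (tnormC T hx' hy'); exact: tnorm_mono.
Qed.

Lemma tnorm0x x : x \in `[0, 1] -> T 0 x = 0.
Proof.
move=> hx; apply/eqP; rewrite eq_le (in01_ge0 (tnorm01 T in01_0 hx)) andbT.
rewrite (tnormC T in01_0 hx) -[leRHS](tnorm1x T in01_0).
by apply: tnorm_le => //; [exact: in01_1|exact: in01_0|exact: in01_0|exact: in01_le1].
Qed.

Lemma tnorm_sup_le x A M : x \in `[0, 1] -> A `<=` `[0, 1] -> 0 <= M ->
  (forall y, A y -> T x y <= M) -> T x (sup A) <= M.
Proof.
move=> hx A01 M0 AM.
have [->|/set0P A0] := eqVneq A set0.
  by rewrite sup0 tnormC ?in01_0// tnorm0x.
have hs := sup01_in A01.
rewrite leNgt; apply/negP => MT.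
have := @tnorm_continuous _ T (x, sup A).
move=> /(_ _ (open_nbhs_nbhs (conj (@open_gt _ M) MT))) /=.
rewrite /nbhs /= -nbhs_subspace_in; last by split.
rewrite /within /= => -[[U V] /= [Ux Vs] UV].
have [e /= e0 eV] := Vs.
have /sup_adherent : 0 < e by [].
move=> /(_ A); case.
  by split => //; exists 1 => y /A01 /=; rewrite in_itv /= => /andP[].
move=> y Ay sy.
have : M < T x y.
  apply: (UV (x, y)) => /=; split => //=; last exact: A01.
    exact: nbhs_singleton.
  apply: eV; rewrite /ball_ /= ger0_norm ?subr_ge0 ?(sup01_ub A01)//.
  by rewrite ltrBlDr addrC -ltrBlDr.
by rewrite ltNge AM.
Qed.

End UnitInterval.

Section DistanceDistributions.
Variable R : realType.
Implicit Types f g h : {nonneg \bar R} -> R.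
Implicit Types r s t u : {nonneg \bar R}.

(* For sets of reals [sup set0 = 0], as for joins in [0,1]. *)
Definition is_ddist f : Prop :=
  (forall t, f t \in `[0, 1]) /\
  (forall t, f t = sup [set f s | s in [set s | (s%:num < t%:num)%E]]).

Record ddist := DDist {
  ddist_val :> {nonneg \bar R} -> R;
  _ : `[< is_ddist ddist_val >]
}.

(* The order on ddist is the one inherited from the pointwise order on
   functions. *)
HB.instance Definition _ := [isSub for ddist_val].
HB.instance Definition _ := [Choice of ddist by <:].
HB.instance Definition _ :=
  [SubChoice_isSubPOrder of ddist by <: with FunOrder.fun_display].

Implicit Types phi psi chi : ddist.

Lemma ddist_leP phi psi : reflect (forall t, phi t <= psi t) (phi <= psi)%O.
Proof. exact: lefP. Qed.

Lemma ddist_ext phi psi : (forall t, phi t = psi t) -> phi = psi.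
Proof. by move=> e; apply: val_inj; apply/funext. Qed.

Definition mk_ddist f (H : is_ddist f) : ddist := DDist (asboolT H).

Lemma ddist01 phi t : phi t \in `[0, 1].
Proof. by case: phi => f /= /asboolP[]. Qed.

Lemma ddist_sup phi t :
  phi t = sup [set phi s | s in [set s | (s%:num < t%:num)%E]].
Proof. by case: phi => f /= /asboolP[]. Qed.

Lemma ddist_img01 phi t :
  [set phi s | s in [set s | (s%:num < t%:num)%E]] `<=` `[0, 1].
Proof. by move=> _ [s _ <-]; exact: ddist01. Qed.

Lemma ddist_le phi s t : (s%:num <= t%:num)%E -> phi s <= phi t.
Proof.
rewrite le_eqVlt => /predU1P[st|st]; first by rewrite (val_inj st).
by rewrite [leRHS]ddist_sup; apply: (sup01_ub (@ddist_img01 phi t)); exists s.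
Qed.

Lemma ddist_approx phi t (M : R) : 0 <= M ->
  (forall s, (s%:num < t%:num)%E -> phi s <= M) -> phi t <= M.
Proof.
by move=> M0 H; rewrite ddist_sup; apply: sup01_le => // _ [s st <-]; exact: H.
Qed.

Lemma is_ddistI f : (forall t, f t \in `[0, 1]) ->
  (forall s t, (s%:num < t%:num)%E -> f s <= f t) ->
  (forall t (M : R), 0 <= M ->
     (forall s, (s%:num < t%:num)%E -> f s <= M) -> f t <= M) -> is_ddist f.
Proof.
move=> f01 fm fa; split => // t; apply/eqP; rewrite eq_le; apply/andP; split.
  have sub : [set f s | s in [set s | (s%:num < t%:num)%E]] `<=` `[0, 1].
    by move=> _ [s _ <-]; exact: f01.
  apply: fa => [|s st]; first exact/in01_ge0/sup01_in.
  by apply: (sup01_ub sub); exists s.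
by apply: sup01_le => [|_ [s st <-]]; [exact: in01_ge0|exact: fm].
Qed.

Definition ddist_join_fun (A : set ddist) : {nonneg \bar R} -> R :=
  fun t => sup [set phi t | phi in A].

Lemma ddist_join_img01 (A : set ddist) t :
  [set (phi : ddist) t | phi in A] `<=` `[0, 1].
Proof. by move=> _ [phi _ <-]; exact: ddist01. Qed.

Lemma ddist_join_subproof (A : set ddist) : is_ddist (ddist_join_fun A).
Proof.
apply: is_ddistI => [t|s t st|t M M0 H].
- exact/sup01_in/ddist_join_img01.
- apply: sup01_le => [|_ [phi Aphi <-]].
    exact/in01_ge0/sup01_in/ddist_join_img01.
  apply: le_trans (ddist_le phi (ltW st)) _.
  by apply: (sup01_ub (@ddist_join_img01 A t)); exists phi.
- apply: sup01_le => // _ [phi Aphi <-]; apply: ddist_approx => // s st.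
  apply: le_trans (H s st).
  by apply: (sup01_ub (@ddist_join_img01 A s)); exists phi.
Qed.

Definition ddist_join (A : set ddist) : ddist :=
  mk_ddist (ddist_join_subproof A).

Lemma ddist_join_isLub (A : set ddist) : isLub A (ddist_join A).
Proof.
split => [phi Aphi|psi Apsi]; apply/ddist_leP => t.
  by apply: (sup01_ub (@ddist_join_img01 A t)); exists phi.
apply: sup01_le => [|_ [phi Aphi <-]]; first exact/in01_ge0/ddist01.
exact/ddist_leP/Apsi.
Qed.

Lemma isLub_ddist_join (A : set ddist) phi : isLub A phi -> phi = ddist_join A.
Proof.
move=> [ub lub]; have [ub' lub'] := ddist_join_isLub A.
by apply/eqP; rewrite eq_le lub//= lub'.
Qed.

Lemma nneg_exists (x : \bar R) : (0 <= x)%E ->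
  exists t : {nonneg \bar R}, t%:num = x.
Proof.
move=> x0; case: (nonnegeP x0) => [|p].
  by exists (+oo%:nng)%E.
by exists (p%:num%:E%:nng)%E.
Qed.

Lemma nneg_ge0 t : (0 <= t%:num)%E. Proof. by []. Qed.

Lemma nneg_add r s : exists t, t%:num = (r%:num + s%:num)%E.
Proof. by apply: nneg_exists; apply: adde_ge0; exact: nneg_ge0. Qed.

Lemma nneg_dense t : (0 < t%:num)%E ->
  exists s, (0 < s%:num)%E /\ (s%:num < t%:num)%E.
Proof.
case et : (t%:num) => [x| |//] x0.
  have x0' : 0 < x / 2 by rewrite divr_gt0.
  have [s es] := @nneg_exists (x / 2)%:E (ltW x0').
  exists s; rewrite es !lte_fin; split => //.
  by rewrite ltr_pdivrMr// ltr_pMr// ltr1n.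
have [s es] := @nneg_exists 1%E lee01.
by exists s; rewrite es lte01 ltry.
Qed.

Lemma nneg_sub s t : (s%:num < t%:num)%E ->
  exists r, (0 < r%:num)%E /\ (r%:num + s%:num)%E = t%:num.
Proof.
move=> st.
have sfin : s%:num \is a fin_num.
  by rewrite ge0_fin_numE//; exact: lt_le_trans st (leey _).
have st0 : (0 < t%:num - s%:num)%E by rewrite sube_gt0.
have [r er] := nneg_exists (ltW st0).
by exists r; rewrite er; split => //; exact: subeK.
Qed.

(* The map kappa_{0,1}, the unit of the convolution. *)
Definition kappa01_fun : {nonneg \bar R} -> R :=
  fun t => if (0 < t%:num)%E then 1 else 0.

Lemma kappa01_subproof : is_ddist kappa01_fun.
Proof.
rewrite /kappa01_fun; apply: is_ddistI => [t|s t st|t M M0 H].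
- by case: ifP => _; [exact: in01_1|exact: in01_0].
- have -> : (0 < t%:num)%E by exact: le_lt_trans st.
  by case: ifP.
- case: ifP => // /nneg_dense[s [s0 st]].
  by have := H s st; rewrite s0.
Qed.

Definition kappa01 : ddist := mk_ddist kappa01_subproof.

Variable T : ctnorm R.

Definition convolution f g : {nonneg \bar R} -> R := fun t =>
  sup [set T (f rs.1) (g rs.2) | rs in
         [set rs : {nonneg \bar R} * {nonneg \bar R} |
            (rs.1%:num + rs.2%:num)%E = t%:num]].

Lemma conv_img01 phi psi t :
  [set T (phi rs.1) (psi rs.2) | rs in
         [set rs : {nonneg \bar R} * {nonneg \bar R} |
            (rs.1%:num + rs.2%:num)%E = t%:num]] `<=` `[0, 1].
Proof. by move=> _ [rs _ <-]; apply: tnorm01; exact: ddist01. Qed.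

Lemma conv01 phi psi t : convolution phi psi t \in `[0, 1].
Proof. exact/sup01_in/conv_img01. Qed.

Lemma conv_ge phi psi r s t : (r%:num + s%:num)%E = t%:num ->
  T (phi r) (psi s) <= convolution phi psi t.
Proof.
by move=> e; apply: (sup01_ub (@conv_img01 phi psi t)); exists (r, s).
Qed.

Lemma conv_le phi psi t (M : R) : 0 <= M ->
  (forall r s, (r%:num + s%:num)%E = t%:num -> T (phi r) (psi s) <= M) ->
  convolution phi psi t <= M.
Proof. by move=> M0 H; apply: sup01_le => // _ [[r s] /= e <-]; exact: H. Qed.

Lemma convolution_subproof phi psi : is_ddist (convolution phi psi).
Proof.
have D := ddist01.
apply: is_ddistI => [t|s t st|t M M0 H]; first exact: conv01.
- apply: conv_le => [|a b ab]; first exact/in01_ge0/conv01.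
  have [r [_ rst]] := nneg_sub st.
  have [b' eb'] := nneg_add r b.
  apply: le_trans (@conv_ge phi psi a b' t _).
    by apply: tnorm_le => //; apply: ddist_le; rewrite eb' leeDr.
  by rewrite eb' addeCA ab.
- apply: conv_le => // r s rst.
  rewrite (ddist_sup psi); apply: tnorm_sup_le => //; first exact: ddist_img01.
  move=> _ [s' s's <-]; rewrite tnormC// (ddist_sup phi).
  apply: tnorm_sup_le => //; first exact: ddist_img01.
  move=> _ [r' r'r <-]; rewrite tnormC//.
  have [u eu] := nneg_add r' s'.
  apply: le_trans (@conv_ge phi psi r' s' u _) (H u _) => //.
  by rewrite eu -rst; exact: lteD.
Qed.

Definition conv phi psi : ddist := mk_ddist (convolution_subproof phi psi).

Lemma convC : commutative conv.
Proof.
have D := ddist01.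
suff H phi psi : (conv phi psi <= conv psi phi)%O.
  by move=> phi psi; apply/eqP; rewrite eq_le !H.
apply/ddist_leP => t; apply: conv_le => [|r s rs]; first exact/in01_ge0/conv01.
by rewrite tnormC//; apply: conv_ge; rewrite addeC.
Qed.

Lemma convA : associative conv.
Proof.
have D := ddist01.
suff H phi psi chi : (conv phi (conv psi chi) <= conv (conv phi psi) chi)%O.
  move=> phi psi chi; apply/eqP; rewrite eq_le H /=.
  rewrite [leLHS]convC [conv phi psi]convC [leRHS]convC [conv psi chi]convC.
  exact: H.
apply/ddist_leP => t; apply: conv_le => [|r s rs]; first exact/in01_ge0/conv01.
have M0 := in01_ge0 (conv01 (conv phi psi) chi t).
apply: tnorm_sup_le => //; first exact: conv_img01.
move=> _ [[a b] /= ab <-]; rewrite (tnormA T)//.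
have [u eu] := nneg_add r a.
apply: le_trans (@conv_ge (conv phi psi) chi u b t _).
  by apply: tnorm_le => //; [exact: tnorm01|exact: conv_ge].
by rewrite eu -addeA ab.
Qed.

Lemma conv1x : left_id kappa01 conv.
Proof.
have D := ddist01.
move=> phi; apply/eqP; rewrite eq_le; apply/andP; split; apply/ddist_leP => t.
  apply: conv_le => [|r s rs]; first exact: in01_ge0.
  rewrite /= /kappa01_fun; case: ifP => r0; last by rewrite tnorm0x// in01_ge0.
  by rewrite tnorm1x//; apply: ddist_le; rewrite -rs leeDr.
apply: ddist_approx => [|s st]; first exact/in01_ge0/conv01.
have [r [r0 rs]] := nneg_sub st.
apply: le_trans (@conv_ge kappa01 phi r s t rs).
by rewrite /= /kappa01_fun r0 tnorm1x.
Qed.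

Lemma conv_isLub phi (A : set ddist) psi :
  isLub A psi -> isLub (conv phi @` A) (conv phi psi).
Proof.
have D := ddist01.
move=> /isLub_ddist_join ->; split => [_ [chi Achi <-]|chi H];
    apply/ddist_leP => t.
  apply: conv_le => [|r s rs]; first exact/in01_ge0/conv01.
  apply: le_trans (conv_ge phi _ rs); apply: tnorm_le => //.
  by apply: (sup01_ub (@ddist_join_img01 A s)); exists chi.
apply: conv_le => [|r s rs]; first exact: in01_ge0.
apply: tnorm_sup_le => //; [exact: ddist_join_img01|exact: in01_ge0|].
move=> _ [xi Axi <-]; apply: le_trans (conv_ge phi xi rs) _.
by have /ddist_leP := H _ (ex_intro2 _ _ xi Axi erefl); exact.
Qed.

Lemma kappa01_top phi : (phi <= kappa01)%O.
Proof.
have D := ddist01; apply/ddist_leP => t.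
rewrite /= /kappa01_fun; case: ifPn => [_|]; first exact: in01_le1.
rewrite -leNgt => t0; apply: ddist_approx => // s st.
by have := lt_le_trans st t0; rewrite ltNge nneg_ge0.
Qed.

Lemma ddist_complete (A : set ddist) : exists phi, isLub A phi.
Proof. by exists (ddist_join A); exact: ddist_join_isLub. Qed.

Definition ddist_quantale : comm_integral_quantale FunOrder.fun_display :=
  CommIntegralQuantale ddist_complete convA convC conv1x conv_isLub kappa01_top.

End DistanceDistributions.

(* Main.v *)
Require Import Defs.
From mathcomp Require Import all_boot all_order all_algebra.
From mathcomp Require Import all_classical all_reals all_analysis.
From mathcomp Require Import lra.

(** Write [step a] for the distance distribution with value [a] on ]0, 1] and
    [1] beyond.  Then [step 0 <= step (1/2)], but [step 0] is not a multiple
    [step (1/2) * p].  Indeed, in the convolution at [3/2] the terms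
    [step (1/2) r * p s] with [r <= 1] are at most [1/2], so that the value
    [1] of [step 0] there can only come from terms with [r > 1], hence
    [s < 1/2]; this forces [p (1/2) = 1].  But then the convolution at
    [1 = 1/2 + 1/2] is at least [(1/2) * 1 = 1/2], whereas [step 0 1 = 0].
    The estimates [1 * y = y], [x * 1 = x] and [x * y <= x] hold in every
    t-norm, so one pair of distributions serves them all; any value strictly
    between [0] and [1] can replace [1/2] as the height of the first step. *)

Set Implicit Arguments.
Unset Strict Implicit.
Unset Printing Implicit Defensive.

Import Defs Order.TTheory GRing.Theory Num.Theory.

Local Open Scope classical_set_scope.
Local Open Scope ring_scope.

Section StepDistributions.
Variable R : realType.
Implicit Types (a x y : R) (s t : {nonneg \bar R}).

Definition step_fun a t : R :=
  if (1 < t%:num)%E then 1 else if (0 < t%:num)%E then a else 0.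

Lemma step_is_ddist a : a \in `[0, 1] -> is_ddist (step_fun a).
Proof.
move=> a01; have [a0 a1] := (in01_ge0 a01, in01_le1 a01).
rewrite /step_fun; apply: is_ddistI => [t|s t st|t M M0 H].
- case: ifP => _; first exact: in01_1.
  by case: ifP => _ //; exact: in01_0.
- case: (ltP 1%E s%:num) => [s1|_]; first by rewrite (lt_trans s1 st).
  rewrite (le_lt_trans (nneg_ge0 s) st).
  by case: ifP => _; case: ifP.
- case: ifPn => [t1|_].
    have [one eo] := nneg_exists (@lee01 R).
    have := @nneg_sub _ one t; rewrite {1}eo => /(_ t1)[r [r0 rt]].
    have [r' [r'0 r'r]] := nneg_dense r0.
    have [s es] := nneg_add r' one.
    have s1 : (1 < s%:num)%E by rewrite es eo lteDr.
    have := H s; rewrite s1; apply.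
    by rewrite es -rt eo lteD2rE.
  case: ifPn => // /nneg_dense[s [s0 st]].
  by apply: le_trans (H s st); rewrite s0; case: ifP.
Qed.

Definition step a (a01 : a \in `[0, 1]) : ddist R :=
  mk_ddist (step_is_ddist a01).

Lemma step_mono a b (a01 : a \in `[0, 1]) (b01 : b \in `[0, 1]) :
  a <= b -> (step a01 <= step b01)%O.
Proof.
by move=> ab; apply/ddist_leP => t; rewrite /= /step_fun; do 2!case: ifP => // _.
Qed.

Variable T : ctnorm R.

Lemma tnormx1 x : x \in `[0, 1] -> T x 1 = x.
Proof. by move=> x01; rewrite tnormC ?in01_1// tnorm1x. Qed.

Lemma tnorm_lel x y : x \in `[0, 1] -> y \in `[0, 1] -> T x y <= x.
Proof.
move=> x01 y01; rewrite -[leRHS]tnormx1//.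
by apply: tnorm_mono => //; [exact: in01_1|exact: in01_le1].
Qed.

(** Decompositions [t = u + v] with [u <= 1] contribute at most [a]; those
    with [u > 1] leave [v <= s], hence contribute at most [p s]. *)
Lemma conv_step_le a (a01 : a \in `[0, 1]) (p : ddist R) s t :
  (t%:num <= 1 + s%:num)%E -> conv T (step a01) p t <= Num.max a (p s).
Proof.
move=> ts; have [a0 p01] := (in01_ge0 a01, ddist01 p).
apply: conv_le => [|u v uv]; first by rewrite le_max a0.
rewrite le_max /= /step_fun; case: (ltP 1%E u%:num) => u1.
  rewrite tnorm1x//; apply/orP; right; apply: ddist_le.
  rewrite leNgt; apply/negP => sv.
  by move: ts; rewrite -uv leNgt lteD.
apply/orP; left; case: ifP => _; first exact: tnorm_lel.
by rewrite tnorm0x.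
Qed.

(** The multiple of [step a] cannot reach [1] right after [1] without being
    already at least [a] at [1]. *)
Lemma step_not_divides a (a01 : a \in `[0, 1]) (p : ddist R) :
  0 < a < 1 -> conv T (step a01) p <> step (in01_0 R).
Proof.
move=> /andP[a0 a1] e.
have nng (x : R) : 0 <= x -> exists t : {nonneg \bar R}, t%:num = x%:E.
  by move=> x0; apply: nneg_exists; rewrite lee_fin.
have /nng[h eh] : (0 : R) <= 2^-1 by lra.
have /nng[one eo] : (0 : R) <= 1 by lra.
have /nng[t et] : (0 : R) <= 1 + 2^-1 by lra.
have ph : p h = 1.
  apply/eqP; rewrite eq_le in01_le1 ?ddist01//=.
  have /(conv_step_le a01 p) : (t%:num <= 1 + h%:num)%E by rewrite et eh.
  rewrite e /= /step_fun et lte_fin ifT; last by lra.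
  by rewrite le_max leNgt a1.
have hh : (h%:num + h%:num)%E = one%:num.
  by rewrite eh eo -EFinD; congr EFin; lra.
have : T (step a01 h) (p h) <= conv T (step a01) p one by exact: conv_ge.
rewrite e ph tnormx1 ?ddist01//= /step_fun eh eo !lte_fin ltxx ltr01.
by rewrite ifF ?ifT ?[_ <= 0]leNgt ?a0//; apply/negbTE; lra.
Qed.

End StepDistributions.

Theorem proposition4p1 (R : realType) (T : ctnorm R) :
  ~ divisible (ddist_quantale T).
Proof.
have half01 : 2^-1 \in `[0 : R, 1] by rewrite in_itv /=; lra.
have le0 : 0 <= 2^-1 :> R by lra.
move=> /(_ _ _ (step_mono (in01_0 R) half01 le0))[p].
by apply: step_not_divides; lra.
Qed.
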